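(* As $x\to\infty$, the estimate $$\sum_{a,b\le x} H(a,b)<x^{25/13+o(1)}$$ holds, where the sum runs over all pairs $(a,b)$ of positive integers with $a\le x$ and $b\le x$.
   Context: A Heron triangle is a (non-degenerate) triangle whose three side lengths and whose area are all positive integers. For positive integers $a,b$, $H(a,b)$ denotes the number of distinct positive integers $c$ such that $a,b,c$ are the side lengths of a Heron triangle. The notation $o(1)$ stands for a function of $x$ tending to $0$ as $x\to\infty$. *)

(* Defs.v *)
From HB Require Import structures.
From mathcomp Require Import all_boot all_order all_algebra finmap.
From mathcomp Require Import all_classical all_reals all_analysis.
From mathcomp Require Import ring lra.
Import Order.TTheory GRing.Theory Num.Theory.
Import numFieldNormedType.Exports.

Set Implicit Arguments.
Unset Strict Implicit.
Unset Printing Implicit Defensive.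

Local Open Scope classical_set_scope.
Local Open Scope ring_scope.

(* The library norm on R * R is the max norm, hence this definition. *)
Definition euclid_dist (R : realType) (p q : R * R) : R :=
  Num.sqrt ((p.1 - q.1) ^+ 2 + (p.2 - q.2) ^+ 2).

Definition triangle_area (R : realType) (p q r : R * R) : R :=
  `|(q.1 - p.1) * (r.2 - p.2) - (q.2 - p.2) * (r.1 - p.1)| / 2.

(* Non-degeneracy of the triangle p q r is the positivity of its area, which
   is subsumed by (0 < n)%N. *)
Definition heron_triangle (R : realType) (a b c : nat) : Prop :=
  [/\ (0 < a)%N, (0 < b)%N, (0 < c)%N
    & exists p q r : R * R,
        [/\ euclid_dist q r = a%:R, euclid_dist r p = b%:R,
            euclid_dist p q = c%:R
          & exists2 n : nat, (0 < n)%N & triangle_area p q r = n%:R]].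

Definition heron_third_sides (R : realType) (a b : nat) : set nat :=
  [set c | heron_triangle R a b c].

(* fset_set returns the empty set on infinite sets; this lemma shows that
   heron_count below is a genuine cardinal. *)
Lemma finite_heron_third_sides (R : realType) (a b : nat) :
  finite_set (heron_third_sides R a b).
Proof.
apply: (@sub_finite_set _ _ `I_(a + b)); last exact: finite_II.
move=> c [a0 b0 c0 [p [q [r [da db dc [n n0 ar]]]]]] /=.
have sq u v (k : nat) : euclid_dist u v = k%:R :> R ->
    (u.1 - v.1) ^+ 2 + (u.2 - v.2) ^+ 2 = k%:R ^+ 2.
  by move=> <-; rewrite sqr_sqrtr// addr_ge0 ?sqr_ge0.
move: (sq _ _ _ da) (sq _ _ _ db) (sq _ _ _ dc) => {da db dc}.
have : (triangle_area p q r * 2) ^+ 2 = (n%:R * 2) ^+ 2 by rewrite ar.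
rewrite /triangle_area divfK ?pnatr_eq0// real_normK ?num_real//.
case: p q r {ar} => p1 p2 [q1 q2] [r1 r2] /= ha hA hB hC.
have hn : 0 < (n%:R : R) by rewrite ltr0n.
have ha0 : 0 < (a%:R : R) by rewrite ltr0n.
have hb0 : 0 < (b%:R : R) by rewrite ltr0n.
have hc0 : 0 < (c%:R : R) by rewrite ltr0n.
rewrite -(ltr_nat R) natrD.
move: ha hA hB hC hn ha0 hb0 hc0.
move: (n%:R : R) (a%:R : R) (b%:R : R) (c%:R : R) => N A B C.
move=> ha hA hB hC hn ha0 hb0 hc0.
have E : 16 * N ^+ 2 = ((A + B) ^+ 2 - C ^+ 2) * (C ^+ 2 - (A - B) ^+ 2).
  have -> : ((A + B) ^+ 2 - C ^+ 2) * (C ^+ 2 - (A - B) ^+ 2)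
    = 4 * A ^+ 2 * B ^+ 2 - (A ^+ 2 + B ^+ 2 - C ^+ 2) ^+ 2 by ring.
  have -> : 16 * N ^+ 2 = 4 * (N * 2) ^+ 2 by ring.
  by rewrite -ha -hA -hB -hC; ring.
rewrite ltNge; apply/negP => le_ABC.
have N2 : 0 < N ^+ 2 by rewrite exprn_gt0.
have h1 : (A + B) ^+ 2 - C ^+ 2 <= 0.
  by rewrite subr_le0 lerXn2r// nnegrE ltW// addr_gt0.
have h2 : 0 <= C ^+ 2 - (A - B) ^+ 2 by nra.
have := mulr_le0_ge0 h1 h2; rewrite -E; lra.
Qed.

Definition heron_count (R : realType) (a b : nat) : nat :=
  #|` fset_set (heron_third_sides R a b)|%fset.

(* Num.truncn x is the floor of x for x >= 0. *)
Definition heron_sum (R : realType) (x : R) : nat :=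
  (\sum_(1 <= a < (Num.truncn x).+1) \sum_(1 <= b < (Num.truncn x).+1)
    heron_count R a b)%N.

(* Main.v *)
(* Writing a = v + w, b = u + w, c = u + v, Heron's formula says that the
   triangle is Heron iff u v w (u + v + w) is a square.  Four positive integers
   u1 + u2 + u3 = u4 <= X with square product are
     u1 = e p12 p13 p14 r1^2,  u2 = e p12 p23 p24 r2^2,
     u3 = e p13 p23 p34 r3^2,  u4 = e p14 p24 p34 r4^2
   (sort the primes by the parities of their four exponents), so that
   e^2 * prod p_ij * prod r_i <= X^2.  If some r_i exceeds X^(1/4), forget it:
   the other ten variables have product at most X^(7/4) and determine u1, u2,
   u3.  Otherwise forget the largest of the pairs (p12, p34), (p13, p24),
   (p14, p23): the equation u1 + u2 + u3 = u4 gives the ratio of the two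
   forgotten coprime numbers, and the product of the rest is at most X^(5/3).
   As there are X^(7/4 + o(1)) tuples of bounded length with product at most
   X^(7/4), and 7/4 < 25/13, one can even take o = 0. *)
Require Import Defs.
From HB Require Import structures.
From mathcomp Require Import all_boot all_order all_algebra finmap.
From mathcomp Require Import all_classical all_reals all_analysis.
From mathcomp Require Import zify ring lra.
Import Order.TTheory GRing.Theory Num.Theory.
Import numFieldNormedType.Exports.
Local Open Scope classical_set_scope.
Local Open Scope ring_scope.

(** * Parametrising four positive integers whose product is a square *)

Section SquareProduct.
Local Open Scope nat_scope.

(** The product runs over all naturals below [N], non-primes contributing 1, so that products for
    different [u] share one range and multiply factor by factor. *)
Lemma prod_expn_logn (N u : nat) : 0 < u -> u < N ->
  u = \prod_(0 <= p < N) p ^ logn p u.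
Proof.
move=> u0 uN; rewrite -[LHS](partnT u0) (@widen_partn N.-1) ?prednK //; lia.
Qed.

Lemma prod_expn_odd_half (N : nat) (f : nat -> nat) :
  \prod_(0 <= p < N) p ^ f p =
  (\prod_(0 <= p < N) p ^ odd (f p)) * (\prod_(0 <= p < N) p ^ (f p)./2) ^ 2.
Proof.
rewrite -mulnn -!big_split /=; apply: eq_bigr => p _.
by rewrite -!expnD addnn odd_double_half.
Qed.

Lemma coprime_prod_primes (N : nat) (A B : pred nat) :
    (forall p, A p -> prime p) -> (forall p, B p -> prime p) ->
    (forall p, A p -> ~~ B p) ->
  coprime (\prod_(0 <= p < N) p ^ A p) (\prod_(0 <= p < N) p ^ B p).
Proof.
move=> Ap Bp AB.
elim/big_ind: _ => [|x y cx cy|p _]; first by rewrite coprime1n.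
  by rewrite coprimeMl cx.
elim/big_ind: _ => [|x y cx cy|q _]; first by rewrite coprimen1.
  by rewrite coprimeMr cx.
case Ap': (A p); last by rewrite coprime1n.
case Bq: (B q); last by rewrite coprimen1.
have [pp pq] := (Ap _ Ap', Bp _ Bq).
rewrite !expn1 prime_coprime // dvdn_prime2 //.
by apply/eqP => e; move: (AB _ Ap'); rewrite e Bq.
Qed.

(** [pij] divides exactly the two [u] named by its indices, apart from coincidental factors.
    Coprimality is recorded for complementary index pairs: theirs are the ratios that the linear
    equation will determine. *)
Definition square_param (e p12 p13 p14 p23 p24 p34 r1 r2 r3 r4 : nat)
    (u1 u2 u3 u4 : nat) : Prop :=
  [/\ u1 = e * p12 * p13 * p14 * r1 ^ 2, u2 = e * p12 * p23 * p24 * r2 ^ 2,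
      u3 = e * p13 * p23 * p34 * r3 ^ 2, u4 = e * p14 * p24 * p34 * r4 ^ 2
    & [/\ coprime p12 p34, coprime p13 p24 & coprime p14 p23]].

Lemma square_prod_param (u1 u2 u3 u4 m : nat) :
    0 < u1 -> 0 < u2 -> 0 < u3 -> 0 < u4 -> u1 * u2 * u3 * u4 = m ^ 2 ->
  exists e p12 p13 p14 p23 p24 p34 r1 r2 r3 r4,
    square_param e p12 p13 p14 p23 p24 p34 r1 r2 r3 r4 u1 u2 u3 u4.
Proof.
move=> u1_gt0 u2_gt0 u3_gt0 u4_gt0 um.
pose N := (u1 + u2 + u3 + u4).+1.
pose b u p := odd (logn p u).
pose P (A : pred nat) := \prod_(0 <= p < N) p ^ A p.
pose r u := \prod_(0 <= p < N) p ^ (logn p u)./2.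
have bprime u p : b u p -> prime p.
  by rewrite /b lognE; case: (prime p).
(* Each prime has an even total exponent in the product, so its parity in [u4] is the sum of the
   other three. *)
have b4 p : b u4 p = b u1 p (+) b u2 p (+) b u3 p.
  have : odd (logn p (u1 * u2 * u3 * u4)) = odd (logn p (m ^ 2)) by rewrite um.
  rewrite lognX !lognM ?muln_gt0 ?u1_gt0 ?u2_gt0 ?u3_gt0 // oddM !oddD /=.
  rewrite -!/(b _ _).
  by case: (b u1 p); case: (b u2 p); case: (b u3 p); case: (b u4 p).
have uE u : 0 < u -> u < N -> u = P (b u) * r u ^ 2.
  by move=> u0 uN; rewrite {1}(prod_expn_logn N u u0 uN) prod_expn_odd_half.
(* [e] collects the primes with odd exponent in all four numbers, [pij] those with odd exponent in
   exactly [ui] and [uj]; by [b4] no other pattern occurs besides four even exponents. *)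
exists (P (fun p => [&& b u1 p, b u2 p & b u3 p])).
exists (P (fun p => [&& b u1 p, b u2 p & ~~ b u3 p])).
exists (P (fun p => [&& b u1 p, ~~ b u2 p & b u3 p])).
exists (P (fun p => [&& b u1 p, ~~ b u2 p & ~~ b u3 p])).
exists (P (fun p => [&& ~~ b u1 p, b u2 p & b u3 p])).
exists (P (fun p => [&& ~~ b u1 p, b u2 p & ~~ b u3 p])).
exists (P (fun p => [&& ~~ b u1 p, ~~ b u2 p & b u3 p])).
exists (r u1), (r u2), (r u3), (r u4).
split.
- rewrite {1}(uE u1) ?/N; [|exact: u1_gt0|lia].
  congr (_ * _); rewrite /P -!big_split; apply: eq_bigr => p _ /=.
  by case: (b u1 p); case: (b u2 p); case: (b u3 p); rewrite /= ?muln1 ?mul1n.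
- rewrite {1}(uE u2) ?/N; [|exact: u2_gt0|lia].
  congr (_ * _); rewrite /P -!big_split; apply: eq_bigr => p _ /=.
  by case: (b u1 p); case: (b u2 p); case: (b u3 p); rewrite /= ?muln1 ?mul1n.
- rewrite {1}(uE u3) ?/N; [|exact: u3_gt0|lia].
  congr (_ * _); rewrite /P -!big_split; apply: eq_bigr => p _ /=.
  by case: (b u1 p); case: (b u2 p); case: (b u3 p); rewrite /= ?muln1 ?mul1n.
- rewrite {1}(uE u4) ?/N; [|exact: u4_gt0|lia].
  congr (_ * _); rewrite /P -!big_split; apply: eq_bigr => p _ /=.
  by rewrite b4; case: (b u1 p); case: (b u2 p); case: (b u3 p);
    rewrite /= ?muln1 ?mul1n.
split; apply: coprime_prod_primes => p;
  move: (bprime u1 p) (bprime u2 p) (bprime u3 p);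
  case: (b u1 p); case: (b u2 p); case: (b u3 p) => //= h1 h2 h3 _;
  by [apply: h1 | apply: h2 | apply: h3].
Qed.

(** * Recovering the triple from a shortened tuple *)

(** Both p/q and p'/q' are the fraction (C - B)/A in lowest terms. *)
Lemma coprime_ratio_inj (p q p' q' A B C : nat) :
    coprime p q -> coprime p' q' -> 0 < p * A ->
    p * A + q * B = q * C -> p' * A + q' * B = q' * C ->
  p = p' /\ q = q'.
Proof.
rewrite muln_gt0 => pq pq' /andP[_ A0] h h'.
have e : p * q' = p' * q.
  apply/eqP; rewrite -(eqn_pmul2r A0); apply/eqP.
  have e1 : p * A = q * (C - B) by rewrite mulnBr; lia.
  have e2 : p' * A = q' * (C - B) by rewrite mulnBr; lia.
  by rewrite mulnAC e1 [RHS]mulnAC e2; lia.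
split; apply/eqP; rewrite eqn_dvd; apply/andP; split.
- by rewrite -(Gauss_dvdl _ pq) -e dvdn_mulr.
- by rewrite -(Gauss_dvdl _ pq') e dvdn_mulr.
- by rewrite coprime_sym in pq; rewrite -(Gauss_dvdr _ pq) e dvdn_mull.
- by rewrite coprime_sym in pq'; rewrite -(Gauss_dvdr _ pq') -e dvdn_mull.
Qed.

(* The forgotten variables, r_(k+1) for k < 4 and a coprime pair for
   4 <= k < 7, are replaced by 1. *)
Definition square_code (k : nat) (s : seq nat) (u1 u2 u3 : nat) : Prop :=
  exists e p12 p13 p14 p23 p24 p34 r1 r2 r3 r4,
    square_param e p12 p13 p14 p23 p24 p34 r1 r2 r3 r4 u1 u2 u3 (u1 + u2 + u3)
    /\ s = nth [::]
      [:: [:: e; p12; p13; p14; p23; p24; p34; 1; r2; r3; r4];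
          [:: e; p12; p13; p14; p23; p24; p34; r1; 1; r3; r4];
          [:: e; p12; p13; p14; p23; p24; p34; r1; r2; 1; r4];
          [:: e; p12; p13; p14; p23; p24; p34; r1; r2; r3; 1];
          [:: e; 1; p13; p14; p23; p24; 1; r1; r2; r3; r4];
          [:: e; p12; 1; p14; p23; 1; p34; r1; r2; r3; r4];
          [:: e; p12; p13; 1; 1; p24; p34; r1; r2; r3; r4]] k.

(** For [k < 4] at least three of the four numbers can be read off from the code, and the sum gives
    any missing one. For larger [k] the forgotten pair is restored first, by [coprime_ratio_inj]. *)
Lemma square_code_inj (k : nat) (s : seq nat) (u1 u2 u3 v1 v2 v3 : nat) :
    k < 7 -> 0 < u1 -> 0 < u2 -> 0 < u3 ->
    square_code k s u1 u2 u3 -> square_code k s v1 v2 v3 ->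
  [/\ u1 = v1, u2 = v2 & u3 = v3].
Proof.
move=> k7 u1_gt0 u2_gt0 u3_gt0.
move=> [e [p12 [p13 [p14 [p23 [p24 [p34 [r1 [r2 [r3 [r4 [
  [a1 a2 a3 a4 [ac1 ac2 ac3]] ->]]]]]]]]]]]].
move=> [e' [q12 [q13 [q14 [q23 [q24 [q34 [s1 [s2 [s3 [s4 [
  [b1 b2 b3 b4 [bc1 bc2 bc3]]]]]]]]]]]]]].
case: k k7 => [|[|[|[|[|[|[|//]]]]]]] _ /= es; case: es => *; subst e'.
- have e2 : u2 = v2 by rewrite a2 b2; congruence.
  have e3 : u3 = v3 by rewrite a3 b3; congruence.
  have : u1 + u2 + u3 = v1 + v2 + v3 by rewrite a4 b4; congruence.
  by rewrite e2 e3 => /addIn/addIn.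
- have e1 : u1 = v1 by rewrite a1 b1; congruence.
  have e3 : u3 = v3 by rewrite a3 b3; congruence.
  have : u1 + u2 + u3 = v1 + v2 + v3 by rewrite a4 b4; congruence.
  by rewrite e1 e3 => /addIn/addnI.
- have e1 : u1 = v1 by rewrite a1 b1; congruence.
  have e2 : u2 = v2 by rewrite a2 b2; congruence.
  have : u1 + u2 + u3 = v1 + v2 + v3 by rewrite a4 b4; congruence.
  by rewrite e1 e2 => /addnI.
- by split; congruence.
(* Here u1 + u2 is a multiple of [p12], while u3 and u4 are multiples of [p34], with cofactors known
   from the code. The next two cases permute the indices. *)
- subst q13 q14 q23 q24 s1 s2 s3 s4.
  have [? ?] : p12 = q12 /\ p34 = q34.
    apply: (@coprime_ratio_inj _ _ _ _
      (e * (p13 * p14 * r1 ^ 2 + p23 * p24 * r2 ^ 2))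
      (e * p13 * p23 * r3 ^ 2) (e * p14 * p24 * r4 ^ 2)) => //.
    - by rewrite (_ : _ * _ = u1 + u2) ?addn_gt0 ?u1_gt0 // a1 a2; ring.
    - rewrite (_ : p34 * (e * p14 * p24 * r4 ^ 2) = u1 + u2 + u3);
        first by rewrite a1 a2 a3; ring.
      by rewrite a4; ring.
    - rewrite (_ : q34 * (e * p14 * p24 * r4 ^ 2) = v1 + v2 + v3);
        first by rewrite b1 b2 b3; ring.
      by rewrite b4; ring.
  by subst; split.
- subst q12 q14 q23 q34 s1 s2 s3 s4.
  have [? ?] : p13 = q13 /\ p24 = q24.
    apply: (@coprime_ratio_inj _ _ _ _
      (e * (p12 * p14 * r1 ^ 2 + p23 * p34 * r3 ^ 2))
      (e * p12 * p23 * r2 ^ 2) (e * p14 * p34 * r4 ^ 2)) => //.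
    - by rewrite (_ : _ * _ = u1 + u3) ?addn_gt0 ?u1_gt0 // a1 a3; ring.
    - rewrite (_ : p24 * (e * p14 * p34 * r4 ^ 2) = u1 + u2 + u3);
        first by rewrite a1 a2 a3; ring.
      by rewrite a4; ring.
    - rewrite (_ : q24 * (e * p14 * p34 * r4 ^ 2) = v1 + v2 + v3);
        first by rewrite b1 b2 b3; ring.
      by rewrite b4; ring.
  by subst; split.
- subst q12 q13 q24 q34 s1 s2 s3 s4.
  have [? ?] : p23 = q23 /\ p14 = q14.
    rewrite coprime_sym in ac3; rewrite coprime_sym in bc3.
    apply: (@coprime_ratio_inj _ _ _ _
      (e * (p12 * p24 * r2 ^ 2 + p13 * p34 * r3 ^ 2))
      (e * p12 * p13 * r1 ^ 2) (e * p24 * p34 * r4 ^ 2)) => //.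
    - by rewrite (_ : _ * _ = u2 + u3) ?addn_gt0 ?u2_gt0 // a2 a3; ring.
    - rewrite (_ : p14 * (e * p24 * p34 * r4 ^ 2) = u1 + u2 + u3);
        first by rewrite a1 a2 a3; ring.
      by rewrite a4; ring.
    - rewrite (_ : q14 * (e * p24 * p34 * r4 ^ 2) = v1 + v2 + v3);
        first by rewrite b1 b2 b3; ring.
      by rewrite b4; ring.
  by subst; split.
Qed.

(** * Size of the shortened tuples *)

(** X q^4 <= (r q)^4 <= X^8. Fourth powers express the bound X^(7/4) within the naturals. *)
Lemma expn4_bound_large_factor (X r q : nat) :
  0 < X -> X < r ^ 4 -> r * q <= X ^ 2 -> q ^ 4 <= X ^ 7.
Proof.
move=> X0 Xr rq; rewrite -(leq_pmul2l X0) -expnS.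
apply: (@leq_trans (r ^ 4 * q ^ 4)); first by rewrite leq_mul2r ltnW ?orbT.
by rewrite -expnMn (expnM X 2 4) leq_exp2r.
Qed.

(** Since b c <= a^2, the number q = e r b c satisfies q^3 <= (e^2 r a b c)^2 r <= X^5; hence q^12
    <= X^20 <= X^21. *)
Lemma expn4_bound_max_pair (X e r a b c : nat) :
    0 < X -> 0 < e -> r <= X -> b <= a -> c <= a ->
    e ^ 2 * r * (a * b * c) <= X ^ 2 ->
  (e * r * (b * c)) ^ 4 <= X ^ 7.
Proof.
move=> X0 e0 rX ba ca h.
have le5 : (e * r * (b * c)) ^ 3 <= X ^ 5.
  apply: (@leq_trans ((e ^ 2 * r * (a * b * c)) ^ 2 * r)); last first.
    by rewrite (expnD X 4 1) leq_mul // (expnM X 2 2) leq_exp2r.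
  have -> : (e * r * (b * c)) ^ 3 = e ^ 3 * (r ^ 3 * (b * c) ^ 2) * (b * c) by ring.
  have -> : (e ^ 2 * r * (a * b * c)) ^ 2 * r
    = e ^ 4 * (r ^ 3 * (b * c) ^ 2) * (a * a) by ring.
  by apply: leq_mul (leq_mul _ _) (leq_mul _ _) => //; rewrite leq_pexp2l.
rewrite -(@leq_exp2r _ _ 3) // -expnM (expnM _ 3 4).
apply: (@leq_trans ((X ^ 5) ^ 4)); first by rewrite leq_exp2r.
by rewrite -!expnM leq_pexp2l.
Qed.

(** Every entry of a code is 1 or divides one of the three numbers or their sum, so it lies between
    1 and [X]. The first four codes serve when some [ri ^ 4] exceeds [X], the last three when none
    does. *)
Lemma square_code_exists (X u1 u2 u3 m : nat) :
    0 < u1 -> 0 < u2 -> 0 < u3 -> u1 + u2 + u3 <= X ->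
    u1 * u2 * u3 * (u1 + u2 + u3) = m ^ 2 ->
  exists k s, [/\ k < 7, square_code k s u1 u2 u3, size s = 11,
    all (fun n => 0 < n <= X) s & (\prod_(n <- s) n) ^ 4 <= X ^ 7].
Proof.
move=> u1_gt0 u2_gt0 u3_gt0 uX um.
have u4_gt0 : 0 < u1 + u2 + u3 by rewrite addn_gt0 addn_gt0 u1_gt0.
have X0 : 0 < X by apply: leq_trans uX.
have [e [p12 [p13 [p14 [p23 [p24 [p34 [r1 [r2 [r3 [r4 h]]]]]]]]]]] :=
  square_prod_param _ _ _ _ _ u1_gt0 u2_gt0 u3_gt0 u4_gt0 um.
have [a1 a2 a3 a4 _] := h.
have lb x y : 0 < y -> y <= X -> x %| y -> 0 < x <= X.
  by move=> y0 yX xy; rewrite (dvdn_gt0 y0 xy) (leq_trans (dvdn_leq y0 xy)).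
have d1 x := lb x u1 u1_gt0 (leq_trans (leq_trans (leq_addr _ _) (leq_addr _ _)) uX).
have d2 x := lb x u2 u2_gt0 (leq_trans (leq_trans (leq_addl _ _) (leq_addr _ _)) uX).
have d3 x := lb x u3 u3_gt0 (leq_trans (leq_addl _ _) uX).
have d4 x := lb x _ u4_gt0 uX.
have be : 0 < e <= X by apply: d1; rewrite a1 -!mulnA dvdn_mulr.
have b12 : 0 < p12 <= X by apply: d1; rewrite a1 (mulnC e) -!mulnA dvdn_mulr.
have b13 : 0 < p13 <= X by apply: d3; rewrite a3 (mulnC e) -!mulnA dvdn_mulr.
have b14 : 0 < p14 <= X by apply: d4; rewrite a4 (mulnC e) -!mulnA dvdn_mulr.
have b23 : 0 < p23 <= X by apply: d2; rewrite a2 dvdn_mulr // dvdn_mulr // dvdn_mull.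
have b24 : 0 < p24 <= X by apply: d2; rewrite a2 dvdn_mulr // dvdn_mull.
have b34 : 0 < p34 <= X by apply: d3; rewrite a3 dvdn_mulr // dvdn_mull.
have c1 : 0 < r1 <= X by apply: d1; rewrite a1 dvdn_mull // dvdn_mulr.
have c2 : 0 < r2 <= X by apply: d2; rewrite a2 dvdn_mull // dvdn_mulr.
have c3 : 0 < r3 <= X by apply: d3; rewrite a3 dvdn_mull // dvdn_mulr.
have c4 : 0 < r4 <= X by apply: d4; rewrite a4 dvdn_mull // dvdn_mulr.
have u1X : u1 <= X by lia.
have u2X : u2 <= X by lia.
have u3X : u3 <= X by lia.
(* The left side is the square root of u1 u2 u3 u4 <= X^4. *)
have M : e ^ 2 * (r1 * r2 * r3 * r4) * (p12 * p34 * (p13 * p24) * (p14 * p23)) <= X ^ 2.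
  rewrite -(@leq_exp2r _ _ 2) //.
  rewrite (_ : _ ^ 2 = u1 * u2 * u3 * (u1 + u2 + u3)); last first.
    by rewrite a4 a1 a2 a3; ring.
  rewrite (_ : (X ^ 2) ^ 2 = X * X * X * X); last by ring.
  by do !apply: leq_mul.
have e0 : 0 < e by case/andP: be.
(* With [e ^ 2] lowered to [e], the left side is the product of the whole tuple, ready for dropping
   one [ri]. *)
have Me : e * (p12 * p34 * (p13 * p24) * (p14 * p23)) * (r1 * r2 * r3 * r4) <= X ^ 2.
  apply: leq_trans M; rewrite -!mulnA leq_pmul2l //; nia.
have mk k s : k < 7 -> s = nth [::]
      [:: [:: e; p12; p13; p14; p23; p24; p34; 1; r2; r3; r4];
          [:: e; p12; p13; p14; p23; p24; p34; r1; 1; r3; r4];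
          [:: e; p12; p13; p14; p23; p24; p34; r1; r2; 1; r4];
          [:: e; p12; p13; p14; p23; p24; p34; r1; r2; r3; 1];
          [:: e; 1; p13; p14; p23; p24; 1; r1; r2; r3; r4];
          [:: e; p12; 1; p14; p23; 1; p34; r1; r2; r3; r4];
          [:: e; p12; p13; 1; 1; p24; p34; r1; r2; r3; r4]] k ->
    (\prod_(n <- s) n) ^ 4 <= X ^ 7 ->
   exists k s, [/\ k < 7, square_code k s u1 u2 u3, size s = 11,
    all (fun n => 0 < n <= X) s & (\prod_(n <- s) n) ^ 4 <= X ^ 7].
  move=> k7 sE sX; exists k, s; split => //.
  - by exists e, p12, p13, p14, p23, p24, p34, r1, r2, r3, r4.
  - by rewrite sE; case: k k7 {sE} => [|[|[|[|[|[|[|//]]]]]]].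
  - rewrite sE; case: k k7 {sE} => [|[|[|[|[|[|[|//]]]]]]] _;
    by rewrite /= ?be ?b12 ?b13 ?b14 ?b23 ?b24 ?b34 ?c1 ?c2 ?c3 ?c4 ?X0.
clear - X0 M Me mk e0.
case: (ltnP X (r1 ^ 4)) => R1.
  apply: (mk 0) => //; rewrite !big_cons big_nil.
  apply: (expn4_bound_large_factor _ _ _ X0 R1); apply: leq_trans Me.
  by apply: eq_leq; ring.
case: (ltnP X (r2 ^ 4)) => R2.
  apply: (mk 1) => //; rewrite !big_cons big_nil.
  apply: (expn4_bound_large_factor _ _ _ X0 R2); apply: leq_trans Me.
  by apply: eq_leq; ring.
case: (ltnP X (r3 ^ 4)) => R3.
  apply: (mk 2) => //; rewrite !big_cons big_nil.
  apply: (expn4_bound_large_factor _ _ _ X0 R3); apply: leq_trans Me.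
  by apply: eq_leq; ring.
case: (ltnP X (r4 ^ 4)) => R4.
  apply: (mk 3) => //; rewrite !big_cons big_nil.
  apply: (expn4_bound_large_factor _ _ _ X0 R4); apply: leq_trans Me.
  by apply: eq_leq; ring.
have rX : r1 * r2 * r3 * r4 <= X.
  rewrite -(@leq_exp2r _ _ 4) // !expnMn (_ : X ^ 4 = X * X * X * X); last by ring.
  by do !apply: leq_mul.
have [[A1 A2]|[[A1 A2]|[A1 A2]]] :
    (p13 * p24 <= p12 * p34 /\ p14 * p23 <= p12 * p34) \/
    (p12 * p34 <= p13 * p24 /\ p14 * p23 <= p13 * p24) \/
    (p12 * p34 <= p14 * p23 /\ p13 * p24 <= p14 * p23) by lia.
- apply: (mk 4) => //; rewrite !big_cons big_nil.
  rewrite (_ : _ * _ = e * (r1 * r2 * r3 * r4) * (p13 * p24 * (p14 * p23))); last by ring.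
  apply: (expn4_bound_max_pair X e _ (p12 * p34)) => //.
- apply: (mk 5) => //; rewrite !big_cons big_nil.
  rewrite (_ : _ * _ = e * (r1 * r2 * r3 * r4) * (p12 * p34 * (p14 * p23))); last by ring.
  apply: (expn4_bound_max_pair X e _ (p13 * p24)) => //.
  by apply: leq_trans M; apply: eq_leq; ring.
- apply: (mk 6) => //; rewrite !big_cons big_nil.
  rewrite (_ : _ * _ = e * (r1 * r2 * r3 * r4) * (p12 * p34 * (p13 * p24))); last by ring.
  apply: (expn4_bound_max_pair X e _ (p14 * p23)) => //.
  by apply: leq_trans M; apply: eq_leq; ring.
Qed.
End SquareProduct.

(** * Counting triples through their codes *)

(** A relation replaces an injection because a triple may have several codes; the axiom of choice
    selects one. *)
Lemma card_le_rel (T1 T2 : finType) (D : {set T1}) (P : {set T2})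
    (r : T1 -> T2 -> Prop) :
    (forall x, x \in D -> exists2 y, y \in P & r x y) ->
    (forall x x' y, x \in D -> x' \in D -> r x y -> r x' y -> x = x') ->
  (#|D| <= #|P|)%N.
Proof.
move=> ex inj.
have [->|[x0 x0D]] := set_0Vmem D; first by rewrite cards0.
have [y0 _ _] := ex _ x0D.
have /choice[f fP] : forall x, exists y, x \in D -> y \in P /\ r x y.
  move=> x; case: (boolP (x \in D)) => [/ex[y yP rxy]|_]; first by exists y.
  by exists y0.
rewrite -(@card_in_imset _ _ f) => [|x x' xD x'D fxx'].
  by apply/subset_leq_card/fintype.subsetP => _ /imsetP[x xD ->]; have [] := fP _ xD.
have [_ rx] := fP _ xD; have [_ rx'] := fP _ x'D.
by apply: (inj _ _ (f x)) => //; rewrite fxx'.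
Qed.

Section RealBounds.
Variable R : realType.

(** The harmonic sum is at most 1 + ln X, and ln X = ln(X^d)/d <= X^d/d. *)
Lemma sum_inv_le_powR (X : nat) (d : R) : (0 < X)%N -> 0 < d ->
  \sum_(1 <= n < X.+1) n%:R^-1 <= (1 + d^-1) * X%:R `^ d.
Proof.
move=> X0 d0.
have harm : \sum_(1 <= n < X.+1) n%:R^-1 <= 1 + ln (X%:R : R).
  elim: X X0 => // -[|X] IH _; first by rewrite big_nat1 invr1 ln1 addr0.
  rewrite big_nat_recr //=; have IH1 := IH isT.
  (* With n = X + 2, this is ln(1 - 1/n) <= -1/n. *)
  suff h : (X.+2)%:R^-1 <= ln (X.+2)%:R - ln ((X.+1)%:R : R).
    by apply: le_trans (lerD IH1 h) _; rewrite -addrA (addrC (ln _)) subrK.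
  have x1 : 0 < (X.+1%:R : R) by rewrite ltr0n.
  have x2 : 0 < (X.+2%:R : R) by rewrite ltr0n.
  have x2V : 0 < (X.+2%:R : R)^-1 by rewrite invr_gt0.
  have x2V1 : (X.+2%:R : R)^-1 < 1 by rewrite invf_lt1 // ltr1n.
  have : ln (1 + - (X.+2%:R : R)^-1) <= - X.+2%:R^-1.
    by apply: le_ln1Dx; rewrite ltrN2.
  rewrite (_ : 1 + _ = X.+1%:R / X.+2%:R); last first.
    have : (X.+1%:R + 1 : R) != 0 by rewrite natr1 pnatr_eq0.
    by rewrite -(natr1 X.+1); move: (X.+1%:R : R) => y y1; field.
  rewrite ln_div ?posrE //; move: (_^-1) (ln _) (ln _) => *; lra.
apply: (le_trans harm).
have X1 : 1 <= (X%:R : R) by rewrite ler1n.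
have p1 : 1 <= (X%:R : R) `^ d by have := ler_powR X1 (ltW d0); rewrite powRr0.
have : ln ((X%:R : R) `^ d) <= X%:R `^ d.
  have := @le_ln1Dx R (X%:R `^ d - 1).
  by rewrite (addrC 1) subrK => h; apply: le_trans (h _) _; lra.
rewrite ln_powR => h.
have : ln (X%:R : R) <= d^-1 * X%:R `^ d by rewrite -ler_pdivrMl ?invr_gt0 // invrK.
lra.
Qed.

(** Rankin's trick: each counted [f] has 1 <= Z / prod f(i), and the sum of these weights over all
    functions factors into a power. *)
Lemma card_ffun_prod_le (X m : nat) (Z : R) : 0 <= Z ->
  #|[set f : {ffun 'I_m -> 'I_X.+1} |
      [forall i, 0 < f i]%N && ((\prod_i f i)%N%:R <= Z)]%SET|%:R
  <= Z * (\sum_(1 <= n < X.+1) n%:R^-1) ^+ m.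
Proof.
move=> Z0; set S := [set _ | _]%SET.
(* The added index 0 contributes nothing, as its inverse is 0 by convention. *)
have -> : \sum_(1 <= n < X.+1) (n%:R : R)^-1 = \sum_(j < X.+1) (j%:R : R)^-1.
  by rewrite -(big_mkord xpredT (fun j => (j%:R : R)^-1)) big_ltn // invr0 add0r.
rewrite -[X in _ ^+ X](card_ord m) -prodr_const bigA_distr_bigA mulr_sumr.
rewrite -sum1_card natr_sum (bigID (mem S) xpredT) /=.
apply: le_trans (_ : \sum_(f in S) Z * \prod_i (f i)%:R^-1 <= _); last first.
  by rewrite lerDl; apply: sumr_ge0 => f _; rewrite mulr_ge0 // prodr_ge0.
apply: ler_sum => f; rewrite inE => /andP[/forallP f0 fZ].
rewrite prodfV -natr_prod ler_pdivlMr ?mul1r // ltr0n.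
by apply: prodn_gt0.
Qed.

Lemma natr_le_powR_of_expn (p X : nat) (a b : nat) : (0 < a)%N ->
  (p ^ a <= X ^ b)%N -> p%:R <= (X%:R : R) `^ (b%:R / a%:R).
Proof.
move=> a0 h; rewrite powRrM powR_mulrn // -natrX.
have /= h2 : (p ^ a)%N%:R `^ (a%:R^-1) <= ((X ^ b)%N%:R : R) `^ (a%:R^-1).
  by apply: ge0_ler_powR; rewrite ?nnegrE ?invr_ge0 ?ler_nat.
apply: le_trans h2; rewrite natrX -powR_mulrn // -powRrM mulfV ?powRr1 //.
by rewrite pnatr_eq0 -lt0n.
Qed.

(** By Heron's formula, these triples (s - a, s - b, s - c) describe the Heron triangles of
    semiperimeter s <= X. *)
Definition square_triples (X : nat) : {set 'I_X.+1 * 'I_X.+1 * 'I_X.+1} :=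
  [set t : 'I_X.+1 * 'I_X.+1 * 'I_X.+1 | [&& 0 < t.1.1, 0 < t.1.2, 0 < t.2,
    t.1.1 + t.1.2 + t.2 <= X &
    `[< exists m, t.1.1 * t.1.2 * t.2 * (t.1.1 + t.1.2 + t.2) = m ^ 2 >]]%N]%SET.

(** There are 7 kinds of code, each a tuple of 11 entries with product at most X^(7/4). *)
Lemma card_square_triples (X : nat) :
  #|square_triples X|%:R <=
  7 * ((X%:R : R) `^ (7 / 4) * (\sum_(1 <= n < X.+1) n%:R^-1) ^+ 11).
Proof.
set Z := X%:R `^ _.
apply: le_trans (ler_wpM2l _ (@card_ffun_prod_le X 11 Z (powR_ge0 _ _))) => //.
set P := [set _ | _]%SET; rewrite -natrM ler_nat.
rewrite -[X in (_ <= X * _)%N]card_ord -cardsT -cardsX.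
apply: (@card_le_rel _ _ _ _ 
  (fun (t : 'I_X.+1 * 'I_X.+1 * 'I_X.+1) (c : 'I_7 * {ffun 'I_11 -> 'I_X.+1}) =>
  square_code c.1 [seq val (c.2 i) | i <- enum 'I_11] t.1.1 t.1.2 t.2)).
- move=> [[u v] w]; rewrite inE => /and5P[u0 v0 w0 uvwX /asboolP[m um]].
  have [k [s [k7 ks s11 sX sZ]]] := square_code_exists _ _ _ _ _ u0 v0 w0 uvwX um.
  pose f := [ffun i : 'I_11 => inord (nth 0%N s i) : 'I_X.+1].
  have sn i : (i < 11)%N -> (0 < nth 0 s i <= X)%N.
    by move=> i11; apply: (allP sX); rewrite mem_nth ?s11.
  have fs : [seq val (f i) | i <- enum 'I_11] = s.
    apply: (@eq_from_nth _ 0%N); rewrite size_map size_enum_ord ?s11 // => i i11.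
    rewrite (nth_map (Ordinal i11)) ?size_enum_ord // ffunE nth_enum_ord //.
    by rewrite /= inordK // ltnS; case/andP: (sn _ i11).
  exists (Ordinal k7, f); last by rewrite /= fs.
  rewrite inE /= !inE /=; apply/andP; split.
    apply/forallP => i; rewrite ffunE inordK; first by case/andP: (sn _ (ltn_ord i)).
    by rewrite ltnS; case/andP: (sn _ (ltn_ord i)).
  rewrite (_ : (\prod_i f i)%N = (\prod_(n <- s) n)%N); last first.
    by rewrite -fs big_map big_enum.
  exact: natr_le_powR_of_expn sZ.
- move=> [[u v] w] [[u' v'] w'] [[k k7] f]; rewrite inE => /and5P[u0 v0 w0 _ _] _ /=.
  move=> h h'; have /= [] := square_code_inj _ _ _ _ _ _ _ _ k7 u0 v0 w0 h h'.
  by move=> /val_inj -> /val_inj -> /val_inj ->.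
Qed.
End RealBounds.

(** * From Heron triangles to square triples *)

Section Heron.
Variable R : realType.

Lemma heron_triangle_params (a b c : nat) : heron_triangle R a b c ->
  exists u v w m, [/\ 0 < u, 0 < v & 0 < w]%N /\
   [/\ a = v + w, b = u + w, c = u + v & u * v * w * (u + v + w) = m ^ 2]%N.
Proof.
move=> [a0 b0 c0 [p [q [r [da db dc [n n0 ar]]]]]].
have sq x y (k : nat) : euclid_dist x y = k%:R :> R ->
    (x.1 - y.1) ^+ 2 + (x.2 - y.2) ^+ 2 = k%:R ^+ 2.
  by move=> <-; rewrite sqr_sqrtr// addr_ge0 ?sqr_ge0.
move: (sq _ _ _ da) (sq _ _ _ db) (sq _ _ _ dc) => {da db dc}.
have : (triangle_area p q r * 2) ^+ 2 = (n%:R * 2) ^+ 2 by rewrite ar.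
rewrite /triangle_area divfK ?pnatr_eq0// real_normK ?num_real//.
case: p q r {ar} => p1 p2 [q1 q2] [r1 r2] /= ha hA hB hC.
(* Heron's formula in the form given by the law of cosines. *)
have E : 16 * (n%:R : R) ^+ 2 + ((a%:R ^+ 2 + b%:R ^+ 2 - c%:R ^+ 2)) ^+ 2
    = 4 * a%:R ^+ 2 * b%:R ^+ 2.
  have -> : 16 * (n%:R : R) ^+ 2 = 4 * (n%:R * 2) ^+ 2 by ring.
  by rewrite -ha -hA -hB -hC; ring.
(* Only integers occur in the identity, so it descends from [R] to the integers, where factors and
   parities make sense. *)
have EZ : 16 * n%:Z ^+ 2 + (a%:Z ^+ 2 + b%:Z ^+ 2 - c%:Z ^+ 2) ^+ 2
    = 4 * a%:Z ^+ 2 * b%:Z ^+ 2.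
  apply: (@intr_inj R).
  rewrite !(rmorphD, rmorphB, rmorphN, rmorphM, rmorphXn,
    rmorph_nat) /=; exact: E.
have EF : 16 * n%:Z ^+ 2 = (a%:Z + b%:Z + c%:Z) * (a%:Z + b%:Z - c%:Z)
    * (c%:Z + a%:Z - b%:Z) * (c%:Z + b%:Z - a%:Z).
  by rewrite -[LHS](addrK ((a%:Z ^+ 2 + b%:Z ^+ 2 - c%:Z ^+ 2) ^+ 2)) EZ; ring.
have n2 : 0 < 16 * n%:Z ^+ 2 by rewrite mulr_gt0 // exprn_gt0.
(* If one of the last three factors in [EF] were nonpositive, the others would be nonnegative,
   against a positive area. *)
have l1 : (c < a + b)%N.
  rewrite ltnNge; apply/negP => le; move: n2.
  rewrite EF; apply/negP; rewrite -leNgt.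
  by apply: mulr_le0_ge0; [apply: mulr_le0_ge0; [apply: mulr_ge0_le0|]|]; lia.
have l2 : (b < c + a)%N.
  rewrite ltnNge; apply/negP => le; move: n2.
  rewrite EF; apply/negP; rewrite -leNgt.
  by apply: mulr_le0_ge0; [apply: mulr_ge0_le0; [apply: mulr_ge0|]|]; lia.
have l3 : (a < c + b)%N.
  rewrite ltnNge; apply/negP => le; move: n2.
  rewrite EF; apply/negP; rewrite -leNgt.
  by apply: mulr_ge0_le0; [apply: mulr_ge0; [apply: mulr_ge0|]|]; lia.
have EN : (16 * n ^ 2 = (a + b + c) * (a + b - c) * (c + a - b) * (c + b - a))%N.
  apply/eqP; rewrite -eqz_nat !PoszM -!subzn ?(ltnW l1) ?(ltnW l2) ?(ltnW l3) //.
  by rewrite !PoszD -EF.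
(* All four factors have the parity of a + b + c; were they odd, so would be 16 n^2. Hence the
   semiperimeter is an integer. *)
have oddF : ~~ odd (a + b + c).
  apply/negP => o; have : odd (16 * n ^ 2).
    by rewrite EN !oddM !oddB ?(ltnW l1) ?(ltnW l2) ?(ltnW l3) //; lia.
  by rewrite oddM.
pose s := (a + b + c)./2.
have sE : (a + b + c = s * 2)%N by rewrite -[LHS]odd_double_half (negbTE oddF) muln2.
exists (s - a)%N, (s - b)%N, (s - c)%N, n.
split; first by split; lia.
split; [lia|lia|lia|].
apply/eqP; rewrite -(eqn_pmul2l (isT : 0 < 16)%N) EN.
rewrite (_ : (a + b + c = 2 * (s - a + (s - b) + (s - c)))%N); last by lia.
rewrite (_ : (a + b - c = 2 * (s - c))%N); last by lia.
rewrite (_ : (c + a - b = 2 * (s - b))%N); last by lia.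
rewrite (_ : (c + b - a = 2 * (s - a))%N); last by lia.
by apply/eqP; ring.
Qed.

(** Each third side c is u + v for some triple of the set, and u + v + w <= a + b <= 2n. *)
Lemma heron_count_le (n a b : nat) : (a <= n)%N -> (b <= n)%N ->
  (heron_count R a b <=
   #|[set t in square_triples (2 * n) | (t.1.2 + t.2 == a) && (t.1.1 + t.2 == b)]%SET|)%N.
Proof.
move=> an bn; set S := [set t in _ | _]%SET.
rewrite /heron_count cardE.
rewrite -(size_map (fun t : 'I_(2 * n).+1 * 'I_(2 * n).+1 * 'I_(2 * n).+1 =>
  (t.1.1 + t.1.2)%N)).
apply: uniq_leq_size; first exact: fset_uniq.
move=> c; rewrite in_fset_set; last exact: finite_heron_third_sides.
rewrite inE => /heron_triangle_params[u [v [w [m [[u0 v0 w0] [ha hb hc um]]]]]].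
have uX : (u < (2 * n).+1)%N by lia.
have vX : (v < (2 * n).+1)%N by lia.
have wX : (w < (2 * n).+1)%N by lia.
apply/mapP; exists (Ordinal uX, Ordinal vX, Ordinal wX) => //.
rewrite mem_enum !inE /= u0 v0 w0 ha hb !eqxx !andbT /=.
by apply/andP; split; [lia|apply/asboolP; exists m].
Qed.

(** A triple determines a = v + w and b = u + w, so after exchanging the sums it is counted for at
    most one pair. *)
Lemma heron_sum_le (x : R) :
  (heron_sum x <= #|square_triples (2 * Num.truncn x)|)%N.
Proof.
rewrite /heron_sum; set n := Num.truncn x; set D := square_triples _.
apply: leq_trans (_ : \sum_(1 <= a < n.+1) \sum_(1 <= b < n.+1)
  \sum_(t in D) ((t.1.2 + t.2 == a) && (t.1.1 + t.2 == b)) <= _)%N.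
  rewrite !big_nat; apply: leq_sum => a /andP[_ an].
  rewrite !big_nat; apply: leq_sum => b /andP[_ bn].
  apply: leq_trans (heron_count_le n _ _ an bn) _.
  rewrite -sum1_card big_mkcond [X in (_ <= X)%N]big_mkcond /=; apply: leq_sum => t _.
  by rewrite inE; case: (t \in D) => //=; case: andP.
have le1 k : (\sum_(1 <= a < n.+1) (k == a) <= 1)%N.
  rewrite (eq_bigr (fun a => if k == a then 1 else 0)%N); last by move=> a _; case: eqP.
  rewrite -big_mkcond sum1_count (eq_count (a2 := pred1 k)).
    by rewrite count_uniq_mem ?iota_uniq // leq_b1.
  by move=> a; rewrite /= eq_sym.
under eq_bigr => a _ do rewrite exchange_big /=.
rewrite exchange_big -sum1_card; apply: leq_sum => t _ /=.
under eq_bigr => a _ do under eq_bigr => b _ do rewrite -mulnb.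
under eq_bigr => a _ do rewrite -big_distrr /=.
by rewrite -big_distrl /= (leq_mul (le1 _) (le1 _)).
Qed.
End Heron.

(** * The final estimate *)

(** Taking d = 1/104 in the harmonic bound gives the exponent 7/4 + 11/104 = 193/104, below 25/13 =
    200/104; the factor 1 + 104 is 1 + 1/d. *)
Lemma heron_sum_le_powR (R : realType) (x : R) : 1 <= x ->
  (heron_sum x)%:R <= 7 * (1 + 104) ^+ 11 * 2 `^ (193 / 104) * x `^ (193 / 104).
Proof.
move=> x1; have x0 : 0 <= x by apply: le_trans x1.
pose X := (2 * Num.truncn x)%N.
have X0 : (0 < X)%N by rewrite muln_gt0 truncn_gt0.
have Xx : (X%:R : R) <= 2 * x by rewrite natrM ler_pM2l // truncn_le.
apply: (@le_trans _ _ #|square_triples X|%:R); first by rewrite ler_nat heron_sum_le.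
apply: le_trans (card_square_triples R X) _.
have d0 : 0 < (104^-1 : R) by rewrite invr_gt0.
have := sum_inv_le_powR R X _ X0 d0; rewrite invrK; set S := \sum_(_ <= _ < _) _ => hS.
have S0 : 0 <= S by apply: sumr_ge0 => n _; rewrite invr_ge0.
apply: (@le_trans _ _ (7 * (X%:R `^ (7 / 4) * ((1 + 104) * X%:R `^ 104^-1) ^+ 11))).
  rewrite ler_wpM2l // ler_wpM2l ?powR_ge0 //.
  by apply: lerXn2r; rewrite // nnegrE mulr_ge0 ?powR_ge0.
have -> : 7 * (X%:R `^ (7 / 4) * ((1 + 104) * X%:R `^ 104^-1) ^+ 11)
    = 7 * (1 + 104) ^+ 11 * (X%:R : R) `^ (193 / 104).
  rewrite exprMn -[(_ `^ _) ^+ 11]powR_mulrn ?powR_ge0 // -powRrM.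
  rewrite (_ : 193 / 104 = 7 / 4 + 104^-1 * 11%:R :> R); last by field.
  rewrite powRD; first by ring.
  by rewrite pnatr_eq0 -lt0n X0 implybT.
rewrite -[leRHS]mulrA; apply: ler_wpM2l; first by rewrite mulr_ge0 ?exprn_ge0.
by rewrite -powRM //; apply: ge0_ler_powR; rewrite ?nnegrE ?mulr_ge0 ?invr_ge0.
Qed.

Theorem theorem3p1 (R : realType) :
  exists2 o : R -> R, o x @[x --> +oo] --> (0 : R) &
    \forall x \near +oo, (heron_sum x)%:R < x `^ (25 / 13 + o x).
Proof.
exists (fun=> 0); first exact: cvg_cst.
pose K : R := 7 * (1 + 104) ^+ 11 * 2 `^ (193 / 104).
have K0 : 0 < K by rewrite !mulr_gt0 ?exprn_gt0 ?powR_gt0.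
near=> x.
have x1 : 1 <= x by near: x; apply: nbhs_pinfty_ge; rewrite num_real.
(* This makes K < x^(7/104), so the spare exponent 25/13 - 193/104 = 7/104 absorbs the constant. *)
have xK : K `^ (104 / 7) < x by near: x; apply: nbhs_pinfty_gt; rewrite num_real.
have x0 : 0 < x by apply: lt_le_trans x1.
rewrite addr0; apply: le_lt_trans (heron_sum_le_powR R x x1) _; rewrite -/K.
rewrite (_ : 25 / 13 = 7 / 104 + 193 / 104); last by field.
rewrite powRD; last by rewrite (gt_eqF x0) implybT.
rewrite ltr_pM2r ?powR_gt0 //.
have -> : K = (K `^ (104 / 7)) `^ (7 / 104).
  rewrite -powRrM (_ : _ * _ = 1) ?powRr1 ?ltW //; by field.
by apply: gt0_ltr_powR; rewrite ?nnegrE ?powR_ge0 ?(ltW x0) // divr_gt0.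
Unshelve. all: by end_near.
Qed.
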